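(* Let $\mathcal{M}=(M,V)$ be a QP-representation of a reduced QP $(Q,S)$. Then $$E(\mathcal{M})\;\ge\;\sum_{i\in Q_0}\Big(\dim(\ker\beta_i)\cdot\dim(\ker\gamma_i/\mathrm{im}\,\beta_i)+\dim M(i)\cdot\dim V(i)\Big).$$
   Context: **Quivers with potentials (QPs).** Vector spaces are over $\mathbb{C}$. A quiver $Q=(Q_0,Q_1,h,t)$ has finite vertex set $Q_0=\{1,\dots,n\}$, finite arrow set $Q_1$, no loops; an arrow $a$ goes from its tail $t(a)$ to its head $h(a)$. $R=\bigoplus_i\mathbb{C}e_i$ with $e_ie_j=\delta_{ij}e_i$; $A$ is the $R$-bimodule with basis $Q_1$, $e_iAe_j$ being spanned by the arrows $j\to i$; $R\langle\langle A\rangle\rangle=\prod_{d\ge0}A^{\otimes_R d}$ (paths written right to left) with the $\mathfrak{m}$-adic topology, $\mathfrak{m}=\prod_{d\ge1}A^{\otimes_R d}$. A potential $S$ is a possibly infinite linear combination of cyclic paths of positive length, up to cyclic equivalence ($S\sim S'$ if $S-S'$ lies in the closure of the span of all $a_1\cdots a_d-a_2\cdots a_da_1$, $a_1\cdots a_d$ cyclic). Cyclic derivatives are the continuous linear maps with $\partial_a(a_1\cdots a_d)=\sum_{p:a_p=a}a_{p+1}\cdots a_da_1\cdots a_{p-1}$; $J(S)$ is the closure of the two-sided ideal generated by all $\partial_aS$; $\mathcal{P}(Q,S)=R\langle\langle A\rangle\rangle/J(S)$. For arrows $a,b$ with $h(a)=t(b)$, $\partial_{ba}S$ is defined by replacing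 $S$ by a cyclically equivalent potential in which no occurring cyclic path $a_1\cdots a_d$ has $a_1=a$ and then setting $\partial_{ba}(a_1\cdots a_d)=\sum_{\nu:a_{\nu-1}=b,a_\nu=a}a_{\nu+1}\cdots a_da_1\cdots a_{\nu-2}$ (extended linearly and continuously). $(Q,S)$ is reduced if $S\in\mathfrak{m}^3$. **QP-representations.** A QP-representation of $(Q,S)$ is $\mathcal{M}=(M,V)$ with $M$ a finite-dimensional $\mathcal{P}(Q,S)$-module (spaces $M(i)$ and maps $a_M:M(t(a))\to M(h(a))$, annihilated by all sufficiently long paths and all $\partial_aS$) and $V=(V(i))_{i\in Q_0}$ a family of finite-dimensional vector spaces. For $k\in Q_0$ put $M_{\rm in}(k)=\bigoplus_{h(a)=k}M(t(a))$, $M_{\rm out}(k)=\bigoplus_{t(b)=k}M(h(b))$; $\alpha_k:M_{\rm in}(k)\to M(k)$ has components $a_M$, $\beta_k:M(k)\to M_{\rm out}(k)$ has components $b_M$, and $\gamma_k:M_{\rm out}(k)\to M_{\rm in}(k)$ has components $(\partial_{ba}S)_M:M(h(b))\to M(t(a))$. One has $\alpha_k\gamma_k=0$ and $\gamma_k\beta_k=0$. **$E$-invariant.** $E(\mathcal{M})=\dim\mathrm{Hom}_Q(M,M)+\sum_{k=1}^n g_k\dim M(k)$, where $g_k=\dim\ker\gamma_k-\dim M(k)+\dim V(k)$ and $\mathrm{Hom}_Q$ denotes homomorphisms of quiver representations. *)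

(* Defs.v *)
From HB Require Import structures.
From mathcomp Require Import all_boot all_order all_algebra.
From mathcomp Require Import boolp classical_sets functions cardinality fsbigop.
From mathcomp Require Import reals.
From mathcomp Require Export complex.

Set Implicit Arguments.
Unset Strict Implicit.
Unset Printing Implicit Defensive.

Import GRing.Theory Num.Theory VectorInternalTheory.

Local Open Scope ring_scope.

(* Finite direct sums of an indexed family of vector spaces: MathComp only     *)
(* provides {ffun I -> vT}, where all the summands are the same space.         *)

Definition dsum (F : fieldType) (I : finType) (V : I -> vectType F) : Type :=
  {dffun forall i : I, V i}.

Section DirectSum.
Variables (F : fieldType) (I : finType) (V : I -> vectType F).
Implicit Types f g : dsum V.

Definition dproj_fun (i : I) (f : dsum V) : V i := (f : {dffun _}) i.
Definition dmk (v : forall i, V i) : dsum V := [ffun i => v i].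

Lemma dprojE v i : dproj_fun i (dmk v) = v i.
Proof. by rewrite /dproj_fun ffunE. Qed.

Lemma dsumP f g : (forall i, dproj_fun i f = dproj_fun i g) -> f = g.
Proof. by move=> e; apply/ffunP. Qed.

HB.instance Definition _ := Choice.copy (dsum V) {dffun forall i : I, V i}.

Definition dsum_add f g : dsum V := dmk (fun i => dproj_fun i f + dproj_fun i g).
Definition dsum_opp f : dsum V := dmk (fun i => - dproj_fun i f).
Definition dsum_scale c f : dsum V := dmk (fun i => c *: dproj_fun i f).

Fact dsum_addA : associative dsum_add.
Proof. by move=> f g h; apply: dsumP => i; rewrite !dprojE addrA. Qed.
Fact dsum_addC : commutative dsum_add.
Proof. by move=> f g; apply: dsumP => i; rewrite !dprojE addrC. Qed.
Fact dsum_add0 : left_id (dmk (fun=> 0)) dsum_add.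
Proof. by move=> f; apply: dsumP => i; rewrite !dprojE add0r. Qed.
Fact dsum_addN : left_inverse (dmk (fun=> 0)) dsum_opp dsum_add.
Proof. by move=> f; apply: dsumP => i; rewrite !dprojE addNr. Qed.

HB.instance Definition _ := GRing.isZmodule.Build (dsum V)
  dsum_addA dsum_addC dsum_add0 dsum_addN.

Fact dsum_scaleA c d f : dsum_scale c (dsum_scale d f) = dsum_scale (c * d) f.
Proof. by apply: dsumP => i; rewrite !dprojE scalerA. Qed.
Fact dsum_scale1 : left_id 1 dsum_scale.
Proof. by move=> f; apply: dsumP => i; rewrite !dprojE scale1r. Qed.
Fact dsum_scaleDr : right_distributive dsum_scale +%R.
Proof. by move=> c f g; apply: dsumP => i; rewrite !dprojE scalerDr. Qed.
Fact dsum_scaleDl f : {morph dsum_scale^~ f : c d / c + d}.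
Proof. by move=> c d; apply: dsumP => i; rewrite !dprojE scalerDl. Qed.

HB.instance Definition _ := GRing.Zmodule_isLmodule.Build F (dsum V)
  dsum_scaleA dsum_scale1 dsum_scaleDr dsum_scaleDl.

Fact dproj_is_linear i : linear (@dproj_fun i).
Proof. by move=> c f g; rewrite [LHS]dprojE; congr (_ + _); exact: dprojE. Qed.

HB.instance Definition _ i :=
  GRing.isLinear.Build F (dsum V) (V i) _ (@dproj_fun i) (dproj_is_linear i).

Fact dsum_vect_iso : Vector.axiom #|{: {i : I & 'I_(dim (V i))}}| (dsum V).
Proof.
pose fr f := \row_(k < #|{: {i : I & 'I_(dim (V i))}}|)
  v2r (dproj_fun (tag (enum_val k)) f) 0 (tagged (enum_val k)).
exists fr.
  by move=> c f g; apply/rowP => k; rewrite !mxE linearP /= linearP !mxE.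
exists (fun r : 'rV_#|{: {i : I & 'I_(dim (V i))}}| =>
    dmk (fun i => r2v
      (\row_j r 0 (enum_rank (Tagged (fun i => 'I_(dim (V i))) j))))).
  move=> f; apply: dsumP => i; rewrite dprojE; apply: (canLR v2rK).
  by apply/rowP => j; rewrite !mxE enum_rankK.
move=> r; apply/rowP => k; rewrite mxE dprojE r2vK mxE.
by congr (r 0 _); rewrite -[RHS]enum_valK; congr enum_rank; case: (enum_val k).
Qed.

HB.instance Definition _ := Lmodule_hasFinDim.Build F (dsum V) dsum_vect_iso.

Definition dinj_fun (i : I) (v : V i) : dsum V :=
  dmk (dfwith (fun j => 0 : V j) v).

Fact dinj_is_linear i : linear (@dinj_fun i).
Proof.
move=> c u v; apply: dsumP => j; rewrite linearP /= !dprojE.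
have [e | ne_ij] := eqVneq i j; first by case: _ / e; rewrite !dfwith_in.
by rewrite !dfwith_out // scaler0 addr0.
Qed.

HB.instance Definition _ i :=
  GRing.isLinear.Build F (V i) (dsum V) _ (@dinj_fun i) (@dinj_is_linear i).

Definition dproj i : 'Hom(dsum V, V i) := linfun (@dproj_fun i).
Definition dinj i : 'Hom(V i, dsum V) := linfun (@dinj_fun i).

End DirectSum.

Record quiver := Quiver {
  nvert : nat;
  arrow :> finType;
  hd : arrow -> 'I_nvert;
  tl : arrow -> 'I_nvert;
  loopless : forall a, hd a != tl a }.

Section Potentials.
Variables (F : fieldType) (Q : quiver).

(* The word [:: a_1; ...; a_d] stands for a_1 ... a_d, read right to left as   *)
(* a composition: it is a path when t(a_p) = h(a_(p+1)) for all p < d. An      *)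
(* element u of e_j R<<A>> e_i is given by its coefficients u w on the paths w *)
(* from i to j; the empty word then stands for e_i, and occurs only if i = j.  *)

Definition cyclic_path (w : seq Q) : bool :=
  (w != [::]) && cycle (fun a b => tl a == hd b) w.

Record potential := Potential {
  coef :> seq Q -> F;
  coef_cyclic : forall w, coef w != 0 -> cyclic_path w }.

Definition commutator_span (U : seq Q -> F) : Prop :=
  exists2 r : seq (F * seq Q), all (fun p => cyclic_path p.2) r &
    forall w, U w = \sum_(p <- r) p.1 * ((w == p.2)%:R - (w == rot 1 p.2)%:R).

(* S - S' is in the m-adic closure of the span: for all N, some element of the *)
(* span is congruent to S - S' modulo m^N.                                     *)
Definition cyc_equiv (S S' : potential) : Prop :=
  forall N, exists2 U, commutator_span U &
    forall w, (size w < N)%N -> S w - S' w = U w.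

Definition reduced (S : potential) : Prop :=
  exists2 S', cyc_equiv S S' & forall w, S' w != 0 -> (3 <= size w)%N.

(* The continuous linear extension to series of a map D from words to formal   *)
(* sums of words (as sequences) that lowers length by d: only the words of     *)
(* length size u + d contribute to the coefficient of u.                       *)
Definition linext (D : seq Q -> seq (seq Q)) (d : nat) (S : seq Q -> F) :
    seq Q -> F :=
  fun u => \sum_(w : (size u + d).-tuple Q) S w *+ count_mem u (D w).

Definition cder_word (a : Q) (w : seq Q) : seq (seq Q) :=
  [seq drop p.+1 w ++ take p w | p <- iota 0 (size w) & onth w p == Some a].

Definition cder (a : Q) (S : potential) : seq Q -> F :=
  linext (cder_word a) 1 S.

Definition not_starting (a : Q) (S : potential) : Prop :=
  forall w, S (a :: w) = 0.

Section Rotate.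
Variables (a : Q) (S : potential).

Let starts (w : seq Q) := ohead w == Some a.

Definition rotate_coef (w : seq Q) : F :=
  if starts w then 0 else S w + (if starts (rotr 1 w) then S (rotr 1 w) else 0).

Fact rotate_coef_cyclic w : rotate_coef w != 0 -> cyclic_path w.
Proof.
rewrite /rotate_coef; case: ifP => _; first by rewrite eqxx.
have [Sw0 | /coef_cyclic //] := eqVneq (S w) 0.
rewrite Sw0 add0r; case: ifP => _; last by rewrite eqxx.
move/coef_cyclic; rewrite /cyclic_path rotr_cycle.
by rewrite -!size_eq0 size_rotr.
Qed.

Definition rotated : potential := Potential rotate_coef_cyclic.

Lemma rotated_not_starting : not_starting a rotated.
Proof. by move=> w; rewrite /= /rotate_coef /starts /= eqxx. Qed.

Lemma cyclic_starts_rot w : cyclic_path w -> starts w -> ~~ starts (rot 1 w).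
Proof.
case: w => [|x [|y w]] //; rewrite /cyclic_path /starts /=.
  rewrite andbT => /eqP e _; have := loopless x; rewrite e eqxx //.
case/andP => /eqP e _ /eqP [ea]; rewrite /rot /= -ea.
by apply/eqP => -[eyx]; have := loopless x; rewrite e eyx eqxx.
Qed.

Lemma rotated_equiv : cyc_equiv S rotated.
Proof.
move=> N.
pose words := undup (flatten
  [seq [seq tval t | t <- enum {: d.-tuple Q}] | d <- iota 0 N]).
have mem_words w : (size w < N)%N -> w \in words.
  move=> lt_wN; rewrite mem_undup; apply/flattenP.
  exists [seq tval t | t <- enum {: (size w).-tuple Q}].
    by apply/mapP; exists (size w); rewrite ?mem_iota.
  by apply/mapP; exists (in_tuple w); rewrite ?mem_enum.
pose good w := cyclic_path w && starts w.
pose l := [seq w <- words | good w].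
have sum_l (f : seq Q -> F) w :
    (size w < N)%N -> \sum_(p <- l) f p * (w == p)%:R = f w *+ good w.
  move=> lt_wN; rewrite big_filter big_mkcond /=.
  rewrite (bigD1_seq w) ?mem_words ?undup_uniq //= eqxx mulr1 big1 ?addr0.
    by case: (good w).
  by move=> p /negPf; rewrite eq_sym => ->; rewrite mulr0 if_same.
exists (fun w => \sum_(p <- [seq (S p, p) | p <- l])
    p.1 * ((w == p.2)%:R - (w == rot 1 p.2)%:R)).
  exists [seq (S p, p) | p <- l] => //.
  apply/allP => _ /mapP [p + ->] /=.
  by rewrite mem_filter => /andP [/andP []].
move=> w lt_wN; rewrite big_map /=.
under eq_bigr do rewrite mulrBr.
rewrite sumrB sum_l //.
under [X in _ = _ - X]eq_bigr => p _.
  have -> : (w == rot 1 p) = (rotr 1 w == p).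
    by apply/eqP/eqP => [-> | <-]; rewrite ?rotK ?rotrK.
  over.
rewrite sum_l ?size_rotr // /good /rotate_coef.
have cycM v : S v *+ cyclic_path v = S v.
  have [// | nc] := boolP (cyclic_path v).
  by rewrite mulr0n; apply/esym/eqP; apply: contraNT nc; apply: coef_cyclic.
have andM (x : F) (b c : bool) : x *+ (b && c) = x *+ b *+ c.
  by case: b c => [] []; rewrite ?mulr0n ?mulr1n.
rewrite (andM _ (cyclic_path w)) (andM _ (cyclic_path (rotr 1 w))) !cycM.
case sw: (starts w); last by case: starts; rewrite mulr0n ?addr0 ?mulr1n ?mulr0n
  ?subrr ?subr0 // opprD addrA subrr.
case sr: (starts (rotr 1 w)); last by rewrite mulr0n mulr1n.
have [cr | ncr] := boolP (cyclic_path (rotr 1 w)).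
  by have := cyclic_starts_rot cr sr; rewrite rotrK sw.
by rewrite -[S (rotr 1 w)]cycM (negPf ncr) mulr0n mul0rn mulr1n.
Qed.

End Rotate.

Lemma not_starting_exists (a : Q) (S : potential) :
  exists S', cyc_equiv S S' /\ not_starting a S'.
Proof.
exists (rotated a S); split; first exact: rotated_equiv.
exact: rotated_not_starting.
Qed.

Definition cder2_word (b a : Q) (w : seq Q) : seq (seq Q) :=
  [seq drop p.+2 w ++ take p w | p <- iota 0 (size w) &
     (onth w p == Some b) && (onth w p.+1 == Some a)].

(* The result does not depend on the potential provided by cid.                *)
Definition cder2 (b a : Q) (S : potential) : seq Q -> F :=
  linext (cder2_word b a) 2 (sval (cid (not_starting_exists a S))).

End Potentials.

Section Representations.
Variables (F : fieldType) (Q : quiver).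

Record rep := Rep {
  space :> 'I_(nvert Q) -> vectType F;
  rmap : forall a : Q, 'Hom(space (tl a), space (hd a)) }.

Section Action.
Variable M : rep.

(* The identity of M i if i = j (transported along the equality), else 0.      *)
Definition idij (i j : 'I_(nvert Q)) : 'Hom(M i, M j) :=
  if i =P j is ReflectT e then
    ecast k 'Hom(M i, M k) e \1%VF
  else 0.

(* The linear map M i -> M j given by a word, which is 0 unless the word is a  *)
(* path from i to j.                                                           *)
Fixpoint word_map (w : seq Q) (i j : 'I_(nvert Q)) : 'Hom(M i, M j) :=
  if w is a :: w' then
    (idij (hd a) j \o (rmap M a \o word_map w' i (tl a)))%VF
  else idij i j.

Definition nilpotent_rep : Prop :=
  exists N, forall w i j, (N <= size w)%N -> word_map w i j = 0.

(* The action of u in e_j R<<A>> e_i: a finite sum when M is nilpotent.        *)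
Definition act (u : seq Q -> F) (i j : 'I_(nvert Q)) : 'Hom(M i, M j) :=
  \sum_(w \in [set: seq Q]) u w *: word_map w i j.

Definition Min (k : 'I_(nvert Q)) : vectType F :=
  dsum (fun a : {a : Q | hd a == k} => M (tl (val a))).

Definition Mout (k : 'I_(nvert Q)) : vectType F :=
  dsum (fun b : {b : Q | tl b == k} => M (hd (val b))).

Definition alpha (k : 'I_(nvert Q)) : 'Hom(Min k, M k) :=
  \sum_(a : {a : Q | hd a == k})
    (idij (hd (val a)) k \o (rmap M (val a) \o dproj _ a))%VF.

Definition beta (k : 'I_(nvert Q)) : 'Hom(M k, Mout k) :=
  \sum_(b : {b : Q | tl b == k})
    (dinj _ b \o (rmap M (val b) \o idij k (tl (val b))))%VF.

Definition gamma (S : potential F Q) (k : 'I_(nvert Q)) :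
    'Hom(Mout k, Min k) :=
  \sum_(a : {a : Q | hd a == k}) \sum_(b : {b : Q | tl b == k})
    (dinj _ a \o
      (act (cder2 (val b) (val a) S) (hd (val b)) (tl (val a)) \o
        dproj _ b))%VF.

End Action.

Section Hom.
Variables M N : rep.

Definition intertwine_fun (a : Q) (phi : dsum (fun i => 'Hom(M i, N i))) :
    'Hom(M (tl a), N (hd a)) :=
  (dproj_fun (hd a) phi \o rmap M a)%VF - (rmap N a \o dproj_fun (tl a) phi)%VF.

Fact intertwine_is_linear a : linear (intertwine_fun a).
Proof.
move=> c f g; rewrite /intertwine_fun !linearP /=.
rewrite comp_lfunDl comp_lfunDr -comp_lfunZl -comp_lfunZr.
by rewrite scalerBr opprD addrACA.
Qed.

HB.instance Definition _ a :=
  GRing.isLinear.Build F (dsum (fun i => 'Hom(M i, N i)))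
    'Hom(M (tl a), N (hd a)) _ (intertwine_fun a) (intertwine_is_linear a).

Definition HomQ : {vspace dsum (fun i => 'Hom(M i, N i))} :=
  (\bigcap_(a : Q) lker (linfun (intertwine_fun a)))%VS.

Lemma HomQP phi :
  reflect (forall a, (dproj_fun (hd a) phi \o rmap M a
                      = rmap N a \o dproj_fun (tl a) phi)%VF)
          (phi \in HomQ).
Proof.
have E a : (phi \in lker (linfun (intertwine_fun a)))
    = ((dproj_fun (hd a) phi \o rmap M a)%VF
       == (rmap N a \o dproj_fun (tl a) phi)%VF).
  by rewrite memv_ker lfunE /= subr_eq0.
apply: (iffP idP) => [H a | H].
  by apply/eqP; rewrite -E; move: H; rewrite memvE => /subv_bigcapP/(_ a isT).
rewrite memvE; apply/subv_bigcapP => a _.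
by rewrite -memvE E; apply/eqP/H.
Qed.

End Hom.

End Representations.

Record qp_rep (F : fieldType) (Q : quiver) (S : potential F Q) := QPRep {
  mod_of :> rep F Q;
  mod_nilpotent : nilpotent_rep mod_of;
  mod_relations : forall a : Q, act mod_of (cder a S) (hd a) (tl a) = 0;
  dec : 'I_(nvert Q) -> vectType F }.

Section EInvariant.
Variables (F : fieldType) (Q : quiver) (S : potential F Q) (M : qp_rep S).

Definition gvec (k : 'I_(nvert Q)) : int :=
  (\dim (lker (gamma M S k)))%:Z - (\dim {: M k})%:Z + (\dim {: dec M k})%:Z.

Definition Einv : int :=
  (\dim (HomQ M M))%:Z + \sum_(k < nvert Q) gvec k * (\dim {: M k})%:Z.

End EInvariant.

(* Main.v *)
(* Grow a submodule U of M from 0 to M by one vector x, sitting at a vertex k, *)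
(* at a time, first filling up the socle, which is ker beta. Along the way     *)
(* keep a space H of families of endomorphisms of the M(j) that commute with   *)
(* the arrows on U. The next step cuts H by the condition that                 *)
(*   beta (phi_k x) = phi_out (beta x).                                        *)
(* If x is in ker beta, the difference of the two sides lies in im beta. In    *)
(* general it lies in ker gamma: gamma beta = 0, and gamma commutes with phi   *)
(* on U, hence on beta x. Counting dimensions,                                 *)
(*   dim Hom_Q(M, M) >= sum_k (m_k^2 - b_k (m_k - b_k) - (m_k - b_k) c_k)      *)
(* with m = dim M, b = dim ker beta and c = dim ker gamma. Substituting this   *)
(* in the definition of E(M) gives the bound.                                  *)

From HB Require Import structures.
Require Import Defs.
From mathcomp Require Import all_boot all_order all_algebra reals complex.
From mathcomp Require Import boolp classical_sets fsbigop zify.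

Set Implicit Arguments.
Unset Strict Implicit.
Unset Printing Implicit Defensive.

Import Order.TTheory GRing.Theory Num.Theory VectorInternalTheory.
Local Open Scope ring_scope.

(** The theorem reduces to a lower bound for dim [HomQ M M] ([HomQ_ge]); inserted in [Einv], it
    gives the claim by an identity at each vertex. The lower bound is a dimension count. Each
    application of [grow] adjoins to a submodule a vector [x] that all arrows send into it, and cuts
    the space of admissible families by [defect x phi = 0]. A cut costs at most the dimension of a
    space containing all defects: im beta if [x] is in ker beta, ker gamma in general
    ([gamma_defect]). Nilpotency supplies [x] ([exists_extension]). The relations of the module
    enter only through gamma beta = 0 ([gamma_beta]), which rests on the expansion of the derivative
    by [a] as the sum over [b] of the derivative by [ba] times [b] ([cder_rcons]). *)

(** * Cyclic derivatives as sums over rotations of a word *)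

Section CyclicDerivatives.
Variables (F : fieldType) (Q : quiver).
Implicit Types (S : potential F Q) (a b : Q) (u v w : seq Q).

Lemma linextE (D : seq Q -> seq (seq Q)) d (U : seq Q -> F) u v n :
    size v = (size u + d)%N ->
    (forall w, size w = size v ->
      count_mem u (D w) = (\sum_(p < n) (rot p w == v))%N) ->
  linext D d U u = \sum_(p < n) U (rotr p v).
Proof.
move=> sz_v countD; rewrite /linext.
under eq_bigr => w _ do rewrite countD ?size_tuple // -sumrMnr.
rewrite exchange_big /=; apply: eq_bigr => p _.
have sz_r : size (rotr p v) == (size u + d)%N by rewrite size_rotr sz_v.
rewrite (bigD1 (Tuple sz_r)) //= rotrK eqxx big1 ?addr0 // => w.
rewrite -val_eqE /= => ne.
by case: (rot p w =P v) ne => [<-|_]; rewrite ?rotK ?eqxx ?mulr0n.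
Qed.

Lemma count_map_filter (f : nat -> seq Q) (P : pred nat) u n :
  count_mem u [seq f p | p <- iota 0 n & P p]
  = (\sum_(p < n) (P p && (f p == u)))%N.
Proof.
rewrite count_map count_filter -sum1_count big_mkcond /=.
rewrite -(big_mkord xpredT (fun p => nat_of_bool (P p && (f p == u)))).
by rewrite /index_iota subn0; apply: eq_bigr => p _; rewrite /= andbC; case: ifP.
Qed.

Lemma rot_eq_cons w p a u : (p < size w)%N ->
  (rot p w == a :: u) = (onth w p == Some a) && (drop p.+1 w ++ take p w == u).
Proof.
move=> lt_p; rewrite /rot (drop_nth a lt_p) cat_cons eqseq_cons; congr (_ && _).
by rewrite onthE (nth_map a).
Qed.

Lemma cderE a S u : cder a S u = \sum_(p < (size u).+1) S (rotr p (a :: u)).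
Proof.
apply: linextE => [|w sz_w]; first by rewrite addn1.
rewrite /cder_word count_map_filter sz_w; apply: eq_bigr => p _.
by rewrite rot_eq_cons ?sz_w.
Qed.

Lemma cder2E b a S u : cder2 b a S u =
  \sum_(p < (size u).+1) sval (cid (not_starting_exists a S)) (rotr p (b :: a :: u)).
Proof.
apply: linextE => [|w sz_w]; first by rewrite addn2.
rewrite /cder2_word count_map_filter sz_w.
rewrite -[size [:: _, _ & _]]/(size u).+2 big_ord_recr.
(* The last position of [w] has no successor, so it contributes nothing; this leaves [(size u).+1]
   rotations. *)
rewrite (@onth_default _ (size u).+2) ?sz_w // andbF; apply: etrans (addn0 _) _.
apply: eq_bigr => p _ /=; have lt_p : (p.+1 < size w)%N by rewrite sz_w ltnS.
rewrite rot_eq_cons 1?ltnW // -andbA; congr (_ && _).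
rewrite (drop_nth a lt_p) cat_cons eqseq_cons; congr (_ && _).
have: onth w p.+1 = Some (nth a w p.+1) by rewrite onthE (nth_map a).
by move=> /= ->.
Qed.

Lemma rotr1_rotr n w : (n < size w)%N -> rotr 1 (rotr n w) = rotr n.+1 w.
Proof.
move=> lt_n; rewrite [rotr n w]/rotr -(subnSK lt_n) rotS ?rotK //.
by rewrite -subn_gt0 subKn.
Qed.

(* The sum of a commutator along the orbit of a word telescopes. *)
Lemma commutator_span_orbit (U : seq Q -> F) w :
  commutator_span U -> \sum_(p < size w) U (rotr p w) = 0.
Proof.
case=> r _ UE; under eq_bigr => p _ do rewrite UE.
rewrite exchange_big /= big1 // => -[c v] _ /=.
rewrite -mulr_sumr sumrB.
pose f p : F := (rotr p w == v)%:R.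
have -> : \sum_(p < size w) (rotr p w == rot 1 v)%:R = \sum_(p < size w) f p.+1.
  apply: eq_bigr => p _; rewrite /f -rotr1_rotr //; congr (_%:R).
  by congr nat_of_bool; apply/eqP/eqP => [->|<-]; rewrite ?rotK ?rotrK.
rewrite -sumrB -(big_mkord xpredT (fun p => f p - f p.+1)).
under eq_bigr do rewrite -opprB.
rewrite sumrN telescope_sumr // /f /rotr subnn rot0 subn0 rot_size.
by rewrite subrr oppr0 mulr0.
Qed.

Lemma cder_cyc_equiv a S S' : cyc_equiv S S' -> cder a S =1 cder a S'.
Proof.
move=> eqS u; apply/eqP; rewrite !cderE -subr_eq0 -sumrB.
(* This precision covers all rotations of [a :: u], whose length is [(size u).+1]. *)
have [U sU SU] := eqS (size u).+2.
rewrite -[X in _ == X](commutator_span_orbit (a :: u) sU) /=; apply/eqP.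
by apply: eq_bigr => p _; rewrite SU // size_rotr.
Qed.

(** This coefficient is that of the word [[:: a]] in [S], which would be a loop. It is the one
    coefficient out of reach of [cder_rcons]. *)
Lemma cder_nil a S : cder a S [::] = 0.
Proof.
rewrite cderE big_ord_recl big_ord0 addr0 /=.
apply/eqP; apply: contraT => /coef_cyclic; rewrite /cyclic_path /= andbT.
by rewrite eq_sym (negPf (loopless a)).
Qed.

(** Cyclic equivalence preserves [cder], so [S] may be replaced by the representative used in
    [cder2]. There the unrotated word vanishes, as it starts with [a]; the other rotations of
    [a :: rcons u b] are those of [b :: a :: u]. *)
Lemma cder_rcons a b S u : cder a S (rcons u b) = cder2 b a S u.
Proof.
rewrite cder2E; case: cid => S' /= [eqS nsS].
rewrite (cder_cyc_equiv a eqS) cderE big_ord_recl /= size_rcons.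
rewrite {1}/rotr subn0 rot_size nsS add0r; apply: eq_bigr => p _.
rewrite /bump add1n -rotr1_rotr; last by rewrite /= size_rcons ltnS ltnW.
by rewrite rotr_rotr -rcons_cons rotr1_rcons.
Qed.

End CyclicDerivatives.

(** * Enumeration of short words *)

Section Words.
Variable T : finType.

(** Built by [rcons], so that a sum over nonempty words splits by the last letter, as [cder_rcons]
    requires. *)
Fixpoint words (n : nat) : seq (seq T) :=
  if n is n'.+1 then [::] :: [seq rcons u b | u <- words n', b <- enum T] else [::].

Lemma mem_words n w : (w \in words n) = (size w < n)%N.
Proof.
elim: n w => [|n IHn] w; first by rewrite in_nil.
rewrite inE; case: (lastP w) => [//|u b]; rewrite size_rcons ltnS -IHn.
have -> : (rcons u b == [::]) = false by case: u.
apply/allpairsP/idP => [[[u' b'] [/= + _]] /rcons_inj [-> _] //|u_n].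
by exists (u, b); rewrite mem_enum.
Qed.

Lemma words_uniq n : uniq (words n).
Proof.
elim: n => //= n IHn; apply/andP; split.
  by apply/allpairsP => -[[u b] [_ _]] /=; case: u.
apply: allpairs_uniq; rewrite ?enum_uniq // => -[u b] [u' b'] _ _ /=.
by move/rcons_inj => [-> ->].
Qed.

End Words.

(** * Action of words and series on a nilpotent representation *)

Section Action.
Variables (F : fieldType) (Q : quiver) (M : rep F Q).
Implicit Types (i j k : 'I_(nvert Q)).

Lemma idijE i : idij M i i = \1%VF.
Proof. by rewrite /idij; case: eqP => // e; rewrite (eq_axiomK e). Qed.

Lemma idij_id i (x : M i) : idij M i i x = x.
Proof. by rewrite idijE lfunE. Qed.

Lemma idij_neq i j : i != j -> idij M i j = 0.
Proof. by rewrite /idij; case: eqP. Qed.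

Lemma idij_natural (phi : forall i, 'Hom(M i, M i)) i j x :
  idij M i j (phi i x) = phi j (idij M i j x).
Proof.
have [e | ne] := eqVneq i j; last by rewrite idij_neq // !lfunE /= linear0.
by case: _ / e; rewrite !idij_id.
Qed.

Lemma word_map_rcons u b i j : word_map M (rcons u b) i j
  = (word_map M u (hd b) j \o (rmap M b \o idij M i (tl b)))%VF.
Proof.
elim: u j => [|a u IHu] j //=.
by rewrite IHu !comp_lfunA.
Qed.

Lemma act_words n (U : seq Q -> F) i j :
    (forall w i j, (n <= size w)%N -> word_map M w i j = 0) ->
  act M U i j = \sum_(w <- words Q n) U w *: word_map M w i j.
Proof.
move=> nilM; rewrite /act (@fsbigE _ _ _ _ _ (words Q n)) ?words_uniq //.
  by apply: eq_bigl => w; rewrite in_setT.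
by move=> w _; rewrite mem_words -leqNgt => /nilM ->; rewrite scaler0.
Qed.

Definition stable (U : forall k, {vspace M k}) : Prop :=
  forall a x, x \in U (tl a) -> rmap M a x \in U (hd a).

(** The maps are defined on all of [M] and need not preserve [U]; only the argument [x] is
    restricted to [U]. *)
Definition intertwines (U : forall k, {vspace M k})
    (phi : forall k, 'Hom(M k, M k)) : Prop :=
  forall a x, x \in U (tl a) -> phi (hd a) (rmap M a x) = rmap M a (phi (tl a) x).

Section Stable.
Variable U : forall k, {vspace M k}.
Hypothesis stU : stable U.

Lemma idij_stable i j x : x \in U i -> idij M i j x \in U j.
Proof.
have [e | ne] := eqVneq i j; last by rewrite idij_neq // lfunE mem0v.
by case: _ / e; rewrite idij_id.
Qed.

Lemma word_map_stable w i j x : x \in U i -> word_map M w i j x \in U j.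
Proof.
elim: w j => [|a w IHw] j Ux /=; first exact: idij_stable.
by rewrite !comp_lfunE idij_stable // stU // IHw.
Qed.

Lemma word_map_intertwines phi w i j x : intertwines U phi -> x \in U i ->
  word_map M w i j (phi i x) = phi j (word_map M w i j x).
Proof.
move=> phiU Ux; elim: w j => [|a w IHw] j /=; first exact: idij_natural.
by rewrite !comp_lfunE IHw -phiU ?word_map_stable // idij_natural.
Qed.

Lemma act_intertwines (u : seq Q -> F) phi i j x :
    nilpotent_rep M -> intertwines U phi -> x \in U i ->
  act M u i j (phi i x) = phi j (act M u i j x).
Proof.
move=> [n nilM] phiU Ux; rewrite (act_words _ _ _ nilM) !sum_lfunE linear_sum.
by apply: eq_bigr => w _; rewrite !lfunE /= linearZ word_map_intertwines.
Qed.

End Stable.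

Lemma dproj_beta k (b : {b : Q | tl b == k}) x :
  dproj_fun b (beta M k x) = rmap M (val b) (idij M k (tl (val b)) x).
Proof.
rewrite /beta sum_lfunE linear_sum (bigD1 b) //= big1 ?addr0 => [|c ne].
  by rewrite !comp_lfunE lfunE /= dprojE dfwith_in.
by rewrite comp_lfunE lfunE /= dprojE dfwith_out.
Qed.

Lemma dproj_gamma S k (a : {a : Q | hd a == k}) y :
  dproj_fun a (gamma M S k y) = \sum_(b : {b : Q | tl b == k})
    act M (cder2 (val b) (val a) S) (hd (val b)) (tl (val a)) (dproj_fun b y).
Proof.
rewrite /gamma sum_lfunE linear_sum (bigD1 a) //= [X in _ + X]big1 ?addr0.
  rewrite sum_lfunE linear_sum; apply: eq_bigr => b _.
  by rewrite !comp_lfunE /= !lfunE /= dprojE dfwith_in.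
move=> c ne; rewrite sum_lfunE linear_sum big1 // => b _.
by rewrite comp_lfunE /= lfunE /= dprojE dfwith_out.
Qed.

Lemma act_cder S a i j : nilpotent_rep M ->
  act M (cder a S) i j = \sum_b
    (act M (cder2 b a S) (hd b) j \o (rmap M b \o idij M i (tl b)))%VF.
Proof.
(* Removing the last letter shortens words by one, so the left side is truncated at [n.+1] and the
   right side at [n]. *)
case=> n nilM; have nilM1 w i' j' : (n < size w)%N -> word_map M w i' j' = 0.
  by move=> lt_n; apply: nilM; apply: ltnW.
rewrite (act_words _ _ _ nilM1) /= big_cons cder_nil scale0r add0r.
rewrite big_allpairs_dep exchange_big big_enum /=; apply: eq_bigr => b _.
rewrite (act_words _ _ _ nilM); apply/lfunP => x.
rewrite comp_lfunE !sum_lfunE. apply: eq_bigr => u _.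
by rewrite cder_rcons word_map_rcons comp_lfunZl [LHS]comp_lfunE.
Qed.

End Action.

(** * Dimension counts *)

Section Dimension.
Variable F : fieldType.

Lemma dim_dsum (I : finType) (V : I -> vectType F) :
  \dim {: dsum V} = (\sum_i \dim {: V i})%N.
Proof.
rewrite dimvf /dim /= card_tagged sumnE big_map big_enum /=.
by apply: eq_bigr => i _; rewrite card_ord dimvf.
Qed.

Lemma dim_Hom (V W : vectType F) :
  \dim {: 'Hom(V, W)} = (\dim {: V} * \dim {: W})%N.
Proof. by rewrite !dimvf. Qed.

Lemma dimv_add_line (V : vectType F) (U : {vspace V}) v :
  v \notin U -> \dim (U + <[v]>) = (\dim U).+1.
Proof.
move=> Uv; have v0 : v != 0 by apply: contraNneq Uv => ->; rewrite mem0v.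
rewrite dimv_disjoint_sum ?dim_vline ?v0 ?addn1 //.
apply/eqP; rewrite -subv0; apply/subvP => w /memv_capP[Uw /vlineP[c def_w]].
have [c0 | c0] := eqVneq c 0; first by rewrite def_w c0 scale0r mem0v.
by case/negP: Uv; rewrite -[v]scale1r -(mulVf c0) -scalerA -def_w memvZ.
Qed.

Lemma dim_lker_ge (V W : vectType F) (f : 'Hom(V, W)) (U : {vspace V})
    (Y : {vspace W}) : (forall u, u \in U -> f u \in Y) ->
  (\dim U <= \dim (U :&: lker f) + \dim Y)%N.
Proof.
move=> fY; rewrite -(limg_ker_dim f U) leq_add2l dimvS //.
by apply/subvP => _ /memv_imgP[u Uu ->]; apply: fY.
Qed.

End Dimension.

(** * Growing a submodule and bounding dim Hom and E *)

Section QPRepresentations.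
Variables (F : fieldType) (Q : quiver) (S : potential F Q) (M : qp_rep S).
Implicit Types (i j k : 'I_(nvert Q)).

Lemma gamma_beta k x : gamma M S k (beta M k x) = 0.
Proof.
apply: dsumP => -[a /= a_k]; rewrite dproj_gamma linear0 /=.
have ea := eqP a_k; move: x a_k; case: _ / ea => x _.
under eq_bigr => b _ do rewrite dproj_beta.
pose f b := act M (cder2 b a S) (hd b) (tl a) (rmap M b (idij M (hd a) (tl b) x)).
have := congr1 (fun g : 'Hom(_, _) => g x) (mod_relations M a).
rewrite (act_cder _ _ _ _ (mod_nilpotent M)) lfunE sum_lfunE /=.
apply: etrans; rewrite [RHS](bigID (fun b => tl b == hd a)) /= [X in _ + X]big1 ?addr0.
  apply: etrans (esym (@big_sub _ _ _ _ (fun b => tl b == hd a) f)) _.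
  by apply: eq_bigr => b _; rewrite /f !comp_lfunE.
by move=> b ne; rewrite !comp_lfunE idij_neq 1?eq_sym // !lfunE !linear0.
Qed.

Notation endos := (dsum (fun k => 'Hom(M k, M k))).

Section Defect.
Variables (k : 'I_(nvert Q)) (x : M k).

Definition defect (phi : endos) : Mout M k :=
  beta M k (dproj_fun k phi x)
  - dmk (fun b : {b : Q | tl b == k} =>
           dproj_fun (hd (val b)) phi (dproj_fun b (beta M k x))).

Fact defect_is_linear : linear defect.
Proof.
move=> c f g; rewrite /defect linearP /= lfunE /= lfunE /= linearP.
rewrite scalerBr addrACA -opprD; congr (_ - _).
apply: dsumP => b; rewrite linearP /= !dprojE.
by rewrite !lfunE /= lfunE.
Qed.

HB.instance Definition _ :=
  GRing.isLinear.Build F endos (Mout M k) _ defect defect_is_linear.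

Lemma dproj_defect phi (b : {b : Q | tl b == k}) :
  dproj_fun b (defect phi) =
  rmap M (val b) (idij M k (tl (val b)) (dproj_fun k phi x))
  - dproj_fun (hd (val b)) phi (rmap M (val b) (idij M k (tl (val b)) x)).
Proof. by rewrite /defect linearB /= dprojE !dproj_beta. Qed.

Variable U : forall j, {vspace M j}.
Hypothesis stU : stable U.
Hypothesis xU : forall a, rmap M a (idij M k (tl a) x) \in U (hd a).

(** The term beta (phi_k x) dies by gamma beta = 0. The components of beta x lie in [U], where [phi]
    commutes with the action of series; hence gamma sends the other term to the image under [phi] of
    gamma (beta x) = 0. *)
Lemma gamma_defect phi : intertwines U (fun j => dproj_fun j phi) ->
  gamma M S k (defect phi) = 0.
Proof.
move=> phiU; rewrite /defect linearB /= gamma_beta sub0r; apply/eqP.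
rewrite oppr_eq0; apply/eqP/dsumP => a; rewrite dproj_gamma linear0 /=.
have := congr1 (fun y => dproj_fun (tl (val a)) phi (dproj_fun a y)) (gamma_beta x).
rewrite dproj_gamma !linear0 linear_sum; apply: etrans.
apply: eq_bigr => b _; rewrite dprojE dproj_beta.
by rewrite (act_intertwines stU _ _ (mod_nilpotent M) phiU) ?xU.
Qed.

(** Since [idij] vanishes off the diagonal, only the space at [k] changes; this avoids a dependent
    case split on [j]. *)
Definition adjoin j : {vspace M j} := (U j + <[idij M k j x]>)%VS.

Lemma adjoin_id : adjoin k = (U k + <[x]>)%VS.
Proof. by rewrite /adjoin idij_id. Qed.

Lemma adjoin_neq j : j != k -> adjoin j = U j.
Proof.
move=> ne; rewrite /adjoin idij_neq 1?eq_sym // lfunE.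
by apply/addv_idPl; rewrite -memvE mem0v.
Qed.

Lemma adjoin_stable : stable adjoin.
Proof.
move=> a _ /memv_addP[u Uu [_ /vlineP[c ->] ->]].
rewrite linearD linearZ /=; apply: subvP (addvSl _ _) _ _.
by rewrite memvD ?memvZ ?xU ?stU.
Qed.

Lemma adjoin_intertwines phi : intertwines U (fun j => dproj_fun j phi) ->
  defect phi = 0 -> intertwines adjoin (fun j => dproj_fun j phi).
Proof.
move=> phiU phi0 a _ /memv_addP[u Uu [_ /vlineP[c ->] ->]].
rewrite !linearD !linearZ /= phiU //; congr (_ + _ *: _).
have [e | ne] := eqVneq (tl a) k; last first.
  by rewrite idij_neq 1?eq_sym // lfunE !linear0.
have /eqP := congr1 (dproj_fun (exist _ a (introT eqP e))) phi0.
rewrite dproj_defect linear0 subr_eq0 /= => /eqP <-.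
by rewrite (idij_natural (fun j => dproj_fun j phi)).
Qed.

End Defect.

(** The nonzero nilpotent quotient M/U has a nonzero socle. Otherwise every vector outside [U] would
    be sent outside [U] by some arrow, giving arbitrarily long words with nonzero action. *)
Lemma exists_extension (U : forall j, {vspace M j}) k :
    stable U -> U k != fullv ->
  exists i (x : M i), x \notin U i /\
    forall a, rmap M a (idij M i (tl a) x) \in U (hd a).
Proof.
move=> stU Uk; apply: contrapT => noext.
have [n nilM] := mod_nilpotent M.
have [x _ Ux] : exists2 x, x \in fullv & x \notin U k.
  by apply/subvPn; rewrite eqEsubv subvf in Uk.
suff [w [j [/nilM w0]]] : exists w j, (n <= size w)%N /\ word_map M w k j x \notin U j.
  by rewrite w0 lfunE mem0v.
suff [w [j [<-]]] : exists w j, size w = n /\ word_map M w k j x \notin U j.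
  by exists w, j.
elim: n {nilM} => [|n [w [j [sz_w Uw]]]].
  by exists [::], k; rewrite /= idij_id.
have [a Ua] : exists a, rmap M a (idij M j (tl a) (word_map M w k j x)) \notin U (hd a).
  apply: contrapT => none; apply: noext; exists j, (word_map M w k j x); split=> // a.
  by apply: contraT => Ua; case: none; exists a.
exists (a :: w), (hd a); split; first by rewrite /= sz_w.
rewrite /= !comp_lfunE idij_id.
have [e | ne] := eqVneq (tl a) j; last first.
  by rewrite idij_neq 1?eq_sym // lfunE linear0 mem0v in Ua.
by move: Ua; case: _ / e; rewrite idij_id.
Qed.

(* The total drop of dim H allowed while growing a submodule from 0 to U at k. *)
Definition cost k (U : {vspace M k}) : nat :=
  (\dim (U :&: lker (beta M k)) * \dim (limg (beta M k))
   + \dim (U :\: lker (beta M k)) * \dim (lker (gamma M S k)))%N.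

(** By the modular law the new line enlarges the part of [U] inside ker beta, and the complement
    keeps its dimension. *)
Lemma cost_line_in k (U : {vspace M k}) x :
    x \in lker (beta M k) -> x \notin U ->
  cost (U + <[x]>) = (cost U + \dim (limg (beta M k)))%N.
Proof.
move=> Kx Ux; rewrite /cost.
have := dimv_cap_compl (U + <[x]>) (lker (beta M k)).
have := dimv_cap_compl U (lker (beta M k)).
rewrite !(capvC _ (lker _)) -vspace_modr -?memvE // !dimv_add_line //; last first.
  by apply: contraNN Ux => /memv_capP[].
by nia.
Qed.

Lemma cost_line_out k (U : {vspace M k}) x :
    (lker (beta M k) <= U)%VS -> x \notin U ->
  cost (U + <[x]>) = (cost U + \dim (lker (gamma M S k)))%N.
Proof.
move=> KU Ux; rewrite /cost.
have := dimv_cap_compl (U + <[x]>) (lker (beta M k)).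
have := dimv_cap_compl U (lker (beta M k)).
rewrite !(capv_idPr _) ?(subv_trans KU) ?addvSl // dimv_add_line //.
by nia.
Qed.

Lemma grow (U : forall j, {vspace M j}) (H : {vspace endos}) k :
    stable U -> (forall phi, phi \in H -> intertwines U (fun j => dproj_fun j phi)) ->
    U k != fullv ->
  exists (U' : forall j, {vspace M j}) (H' : {vspace endos}), [/\ stable U',
    forall phi, phi \in H' -> intertwines U' (fun j => dproj_fun j phi),
    (\sum_j \dim (U' j) = (\sum_j \dim (U j)).+1)%N &
    (\dim H + \sum_j cost (U j) <= \dim H' + \sum_j cost (U' j))%N].
Proof.
move=> stU HU Uk.
have [i [x [Ux xU [Y HY costY]]]] : exists i (x : M i), [/\ x \notin U i,
    forall a, rmap M a (idij M i (tl a) x) \in U (hd a) &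
    exists2 Y : {vspace Mout M i}, (forall phi, phi \in H -> defect x phi \in Y)
             & (cost (U i) + \dim Y <= cost (U i + <[x]>))%N].
  have [[i KU] | KU] := pselect (exists i, ~~ (lker (beta M i) <= U i)%VS).
    have [x Kx Ux] : exists2 x, x \in lker (beta M i) & x \notin U i.
      by have /subvPn := KU.
    have bx0 : beta M i x = 0 by apply/eqP; rewrite -memv_ker.
    have rx0 a : rmap M a (idij M i (tl a) x) = 0.
      have [e | ne] := eqVneq (tl a) i; last first.
        by rewrite idij_neq 1?eq_sym // lfunE linear0.
      have := congr1 (dproj_fun (exist _ a (introT eqP e))) bx0.
      by rewrite dproj_beta linear0.
    exists i, x; split=> // [a|]; first by rewrite rx0 mem0v.
    exists (limg (beta M i)) => [phi _|].
      rewrite /defect bx0 (_ : dmk _ = 0) ?subr0 ?memv_img ?memvf //.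
      by apply: dsumP => b; rewrite dprojE !linear0.
    by rewrite cost_line_in.
  (* Here [U] contains ker beta at every vertex, so the new line enlarges only the complement. *)
  have [i [x [Ux xU]]] := exists_extension stU Uk.
  exists i, x; split=> //; exists (lker (gamma M S i)) => [phi Hphi|].
    by rewrite memv_ker (gamma_defect stU) //; apply: HU.
  rewrite cost_line_out //; apply: contrapT => nKU.
  by apply: KU; exists i; apply/negP.
exists (adjoin x U), (H :&: lker (linfun (defect x)))%VS; split.
- exact: adjoin_stable.
- move=> phi /memv_capP[Hphi]; rewrite memv_ker lfunE /= => /eqP phi0.
  by apply: (adjoin_intertwines _ phi0); apply: HU.
- rewrite (bigD1 i) //= adjoin_id dimv_add_line // addSn.
  rewrite [in RHS](bigD1 i) //=.
  by congr (_ + _).+1; apply: eq_bigr => j ne; rewrite adjoin_neq.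
rewrite (bigD1 i) //= [X in (_ <= _ + X)%N](bigD1 i) //= adjoin_id.
rewrite [X in (_ <= _ + (_ + X))%N](eq_bigr (fun j => cost (U j))); last first.
  by move=> j ne; rewrite adjoin_neq.
have: (\dim H <= \dim (H :&: lker (linfun (defect x))) + \dim Y)%N.
  by apply: dim_lker_ge => phi Hphi; rewrite lfunE HY.
by move: costY; lia.
Qed.

Lemma HomQ_ge : (\sum_k \dim {: M k} * \dim {: M k}
  <= \dim (HomQ M M) + \sum_k cost (fullv : {vspace M k}))%N.
Proof.
have full_case (U : forall j, {vspace M j}) (H : {vspace endos}) :
    (forall phi, phi \in H -> intertwines U (fun j => dproj_fun j phi)) ->
    ~ (exists k, U k != fullv) ->
    (\dim H + \sum_j cost (U j)
      <= \dim (HomQ M M) + \sum_k cost (fullv : {vspace M k}))%N.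
  move=> HU full; have Uf k : U k = fullv.
    by apply/eqP/negPn/negP => Uk; apply: full; exists k.
  under eq_bigr => k _ do rewrite Uf.
  rewrite leq_add2r dimvS //; apply/subvP => phi /HU phiU.
  apply/HomQP => a; apply/lfunP => x; rewrite !comp_lfunE.
  by apply: phiU; rewrite Uf memvf.
(* Induction on a bound [n] for the codimension of [U], started at [U = 0], where every family
   intertwines. *)
suff gr n (U : forall j, {vspace M j}) (H : {vspace endos}) :
    stable U -> (forall phi, phi \in H -> intertwines U (fun j => dproj_fun j phi)) ->
    (\sum_j \dim {: M j} <= \sum_j \dim (U j) + n)%N ->
    (\dim H + \sum_j cost (U j)
      <= \dim (HomQ M M) + \sum_k cost (fullv : {vspace M k}))%N.
  have := gr (\sum_j \dim {: M j})%N (fun=> 0%VS) fullv.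
  rewrite dim_dsum (eq_bigr _ (fun k _ => dim_Hom (M k) (M k))).
  move=> /(_ _ _ (leq_addl _ _)) le; apply: leq_trans (leq_addr _ _) (le _ _).
    by move=> a x; rewrite !memv0 => /eqP ->; rewrite linear0.
  by move=> phi _ a x; rewrite memv0 => /eqP ->; rewrite !linear0.
elim: n U H => [|n IHn] U H stU HU le_n;
  have [[k Uk] | full] := pselect (exists k, U k != fullv).
(* With [n = 0] and [U] not full, growing once more would exceed dim [M]. *)
- have [U' [H' [_ _ dU' _]]] := grow stU HU Uk.
  have: (\sum_j \dim (U' j) <= \sum_j \dim {: M j})%N.
    by apply: leq_sum => j _; rewrite dimvS ?subvf.
  by rewrite dU'; move: le_n; rewrite addn0; lia.
- exact: full_case.
- have [U' [H' [stU' HU' dU' dH']]] := grow stU HU Uk.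
  by apply: leq_trans dH' (IHn _ _ stU' HU' _); rewrite dU' addSnnS.
- exact: full_case.
Qed.

Lemma Einv_ge :
  \sum_(i < nvert Q)
    ((\dim (lker (beta M i)))%:Z *
       (\dim (lker (gamma M S i) :\: limg (beta M i))%VS)%:Z +
     (\dim {: M i})%:Z * (\dim {: dec M i})%:Z)
  <= Einv M.
Proof.
rewrite /Einv /gvec.
have := HomQ_ge; rewrite -lez_nat PoszD !(big_morph Posz PoszD erefl) -lerBlDr.
rewrite -sumrB -[_ <= _ + _]lerBlDr -sumrB; apply: le_trans; apply: ler_sum => k _.
have := limg_ker_dim (beta M k) fullv.
have := dimv_cap_compl fullv (lker (beta M k)).
have := dimv_cap_compl (lker (gamma M S k)) (limg (beta M k)).
have -> : (lker (gamma M S k) :&: limg (beta M k) = limg (beta M k))%VS.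
  apply/capv_idPr/subvP => _ /memv_imgP[x _ ->].
  by rewrite memv_ker gamma_beta.
(* With m = dim M, b = dim ker beta, c = dim ker gamma, v = dim V at [k], this is m^2 - b(m-b) -
   (m-b)c + (c-m+v)m = b(c-(m-b)) + mv. *)
rewrite /cost capfv; nia.
Qed.

End QPRepresentations.

(* For subspaces U, W of the same space, U :\: W is a complement of U :&: W in U; *)
(* as gamma_i beta_i = 0, \dim (lker gamma_i :\: limg beta_i) is the dimension *)
(* of ker gamma_i / im beta_i. *)
Theorem theorem8p1 (R : realType) (Q : quiver) (S : potential R[i] Q)
    (redS : reduced S) (M : qp_rep S) :
  \sum_(i < nvert Q)
    ((\dim (lker (beta M i)))%:Z *
       (\dim (lker (gamma M S i) :\: limg (beta M i))%VS)%:Z +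
     (\dim {: M i})%:Z * (\dim {: dec M i})%:Z)
  <= Einv M.
Proof. exact: Einv_ge. Qed.
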